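(* Let $X$ be a nonempty set, let $\Phi$ be a mapping with the domain $X^{2}$ and let $a_0 \in \Phi(X^{2})$. Then the following statements are equivalent: (i) $\Phi$ is $a_0$-coherent. (ii) $\mathcal{B}_X(P_{\Phi^{-1}})$ is a monoid and $\Phi^{-1}(a_0)$ is the identity element of this monoid.
   Context: A mapping $\Phi$ with domain $X^2 = X\times X$ may take values in an arbitrary set; $\Phi(X^2)$ is its image and $\Phi^{-1}(a)=\{\langle x,y\rangle\in X^2 : \Phi(x,y)=a\}$ is the fiber over $a$. For $a_0\in\Phi(X^2)$, the mapping $\Phi$ is called $a_0$-coherent if $\Phi^{-1}(a_0)$ is an equivalence relation on $X$ and, for all $x_1,x_2,x_3,x_4\in X$, the conditions $\Phi(x_1,x_2)=a_0$ and $\Phi(x_3,x_4)=a_0$ imply $\Phi(x_1,x_3)=\Phi(x_2,x_4)$. $\mathcal{B}_X$ denotes the semigroup of all binary relations on $X$ (all subsets of $X^2$) under composition $\circ$, where $\langle x,y\rangle\in\psi\circ\gamma$ if and only if there is $z\in X$ with $\langle x,z\rangle\in\psi$ and $\langle z,y\rangle\in\gamma$. For a nonempty $A\subseteq\mathcal{B}_X$, $\mathcal{B}_X(A)$ denotes the subsemigroup of $\mathcal{B}_X$ generated by $A$, i.e. the set of all finite compositions $g_1\circ\cdots\circ g_k$, $k\ge 1$, with $g_i\in A$. $P_{\Phi^{-1}}:=\{\Phi^{-1}(a): a\in\Phi(X^2)\}\subseteq\mathcal{B}_X$ is the set of fibers of $\Phi$. A monoid is a semigroup having an identity element (the identity is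 an element of the semigroup itself). *)

(* Defs.v *)
From mathcomp Require Import all_boot.
From mathcomp Require Import classical_sets.
From Stdlib Require Import List Relation_Definitions.

Set Implicit Arguments.
Unset Strict Implicit.
Unset Printing Implicit Defensive.

Local Open Scope classical_set_scope.

(* The left factor acts first.  The notation [\;] of [relation_scope] takes its
   arguments in the other order: [rcomp psi gamma] is [(gamma \; psi)%relation]. *)
Definition rcomp (X : Type) (psi gamma : set (X * X)) : set (X * X) :=
  [set xy | exists2 z, psi (xy.1, z) & gamma (z, xy.2)].

Definition fiber (X Y : Type) (Phi : X * X -> Y) (a : Y) : set (X * X) :=
  Phi @^-1` [set a].

(* [a] ranges over the image of [Phi] only, so the empty relation is never
   added when [Phi] is not surjective. *)
Definition fibers (X Y : Type) (Phi : X * X -> Y) : set (set (X * X)) :=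
  [set fiber Phi a | a in range Phi].

Definition coherent (X Y : Type) (Phi : X * X -> Y) (a0 : Y) : Prop :=
  equivalence X (fun x y => fiber Phi a0 (x, y)) /\
  forall x1 x2 x3 x4 : X,
    Phi (x1, x2) = a0 -> Phi (x3, x4) = a0 -> Phi (x1, x3) = Phi (x2, x4).

(* The compositions g_1 o ... o g_k with k >= 1 and every g_i in [A]:
   [g] is g_1 and [gs] lists g_2, ..., g_k. *)
Definition generated (X : Type) (A : set (set (X * X))) : set (set (X * X)) :=
  [set r | exists g gs, [/\ A g, Forall A gs & r = foldl (@rcomp X) g gs]].

Definition is_semigroup (T : Type) (op : T -> T -> T) (S : set T) : Prop :=
  (forall s t, S s -> S t -> S (op s t)) /\
  (forall s t u, S s -> S t -> S u -> op s (op t u) = op (op s t) u).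

Definition is_identity (T : Type) (op : T -> T -> T) (S : set T) (e : T) : Prop :=
  S e /\ forall s, S s -> op e s = s /\ op s e = s.

Definition is_monoid (T : Type) (op : T -> T -> T) (S : set T) : Prop :=
  is_semigroup op S /\ exists e, is_identity op S e.

(* Main.v *)
(** The fiber [e] over [a0] is neutral for composition with every fiber of [Phi]
    exactly when [Phi] is coherent, and a relation neutral for a set of generators
    is neutral for the semigroup they generate.  For the direction from neutrality
    to coherence, reflexivity of [e] comes first: if [c = Phi (x, x)], then
    [e \o Phi^-1(c) = Phi^-1(c)] gives some [z] with [(x, z)] in [e], and
    [Phi^-1(c) \o e = Phi^-1(c)] then puts [(x, z)] in [Phi^-1(c)], so [c = a0]. *)
Require Import Defs.
From mathcomp Require Import all_boot.
From mathcomp Require Import classical_sets.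
From Stdlib Require List.

Local Open Scope classical_set_scope.

Lemma rcompA (X : Type) : associative (@rcomp X).
Proof.
move=> r s t; apply/seteqP; split=> -[x y] /=.
  by move=> [z rxz [w szw twy]]; exists w => //; exists z.
by move=> [w [z rxz szw] twy]; exists z => //; exists w.
Qed.

(** Associativity lets a left factor be absorbed into the head of the fold, so a product of two
    folds is again a single fold. *)
Lemma rcomp_foldl (X : Type) (r g : set (X * X)) gs :
  rcomp r (foldl (@rcomp X) g gs) = foldl (@rcomp X) (rcomp r g) gs.
Proof. by elim: gs g => [//|h gs IH] g /=; rewrite IH rcompA. Qed.

Lemma generated_sub (X : Type) (A : set (set (X * X))) : A `<=` generated A.
Proof. by move=> g Ag; exists g, [::]. Qed.

Lemma generated_semigroup (X : Type) (A : set (set (X * X))) :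
  is_semigroup (@rcomp X) (generated A).
Proof.
split=> [r s [g [gs [Ag Ags ->]]] [h [hs [Ah Ahs ->]]]|r s t _ _ _];
  last exact: rcompA.
exists g, (gs ++ h :: hs); split=> //; last by rewrite foldl_cat /= rcomp_foldl.
by apply/List.Forall_app; split=> //; apply: List.Forall_cons.
Qed.

Lemma generated_identity (X : Type) (A : set (set (X * X))) (e : set (X * X)) :
  A e -> (forall g, A g -> rcomp e g = g /\ rcomp g e = g) ->
  is_identity (@rcomp X) (generated A) e.
Proof.
move=> Ae neutral; split; first exact: generated_sub.
move=> _ [g [gs [/neutral [eg ge] Ags ->]]]; split; first by rewrite rcomp_foldl eg.
(* The invariant is that [e] is right neutral for the accumulator [g]; it passes to [rcomp g h]
   because [e] is right neutral for [h]. *)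
elim: Ags g ge {eg} => [//|h hs /neutral [_ he] _ IH] g _ /=.
by apply: IH; rewrite -rcompA he.
Qed.

(** Coherence is applied with one of its two pairs on the diagonal, so only one argument of [Phi]
    moves; reflexivity gives the reverse inclusions. *)
Lemma coherent_fiber_neutral {X Y : Type} {Phi : X * X -> Y} {a0 : Y} (b : Y) :
  coherent Phi a0 ->
  rcomp (fiber Phi a0) (fiber Phi b) = fiber Phi b /\
  rcomp (fiber Phi b) (fiber Phi a0) = fiber Phi b.
Proof.
move=> [[refl _ _] coh]; split; apply/seteqP; split=> -[x y].
- by move=> [z /= /coh xz zy]; rewrite /fiber /= (xz _ _ (refl y)).
- by exists x => //=; apply: refl.
- by move=> [z /= xz zy]; rewrite /fiber /= -(coh _ _ _ _ (refl x) zy).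
- by exists y => //=; apply: refl.
Qed.

(** Tested on the fiber through a given pair, neutrality says that [Phi] keeps its value when either
    argument moves along the fiber over [a0]. Moving both in turn gives coherence. *)
Lemma fiber_neutral_coherent (X Y : Type) (Phi : X * X -> Y) (a0 : Y) :
  (forall g, fibers Phi g ->
     rcomp (fiber Phi a0) g = g /\ rcomp g (fiber Phi a0) = g) ->
  coherent Phi a0.
Proof.
move=> neutral.
have left_act x y z : Phi (x, y) = a0 -> Phi (x, z) = Phi (y, z).
  move=> xy; have [|eg _] := neutral (fiber Phi (Phi (y, z))).
    by exists (Phi (y, z)) => //; exists (y, z).
  suff: fiber Phi (Phi (y, z)) (x, z) by [].
  by rewrite -eg; exists y.
have right_act x y z : Phi (y, z) = a0 -> Phi (x, z) = Phi (x, y).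
  move=> yz; have [|_ ge] := neutral (fiber Phi (Phi (x, y))).
    by exists (Phi (x, y)) => //; exists (x, y).
  suff: fiber Phi (Phi (x, y)) (x, z) by [].
  by rewrite -ge; exists y.
have refl x : Phi (x, x) = a0.
  have [|eg _] := neutral (fiber Phi (Phi (x, x))).
    by exists (Phi (x, x)) => //; exists (x, x).
  have : fiber Phi (Phi (x, x)) (x, x) by [].
  by rewrite -{1}eg => -[z /= xz _]; rewrite -(right_act x _ _ xz).
have sym x y : Phi (x, y) = a0 -> Phi (y, x) = a0.
  (* Moving the first argument from [y] to [x] reduces the goal to [refl x]. *)
  by move=> /left_act <-.
split; first split=> //.
  by move=> x y z; rewrite /fiber /= => xy /(right_act x) ->.
by move=> x1 x2 x3 x4 /left_act -> /(right_act x2) ->.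
Qed.

Theorem theorem2p11 (X Y : Type) (hX : inhabited X) (Phi : X * X -> Y) (a0 : Y)
    (ha0 : range Phi a0) :
  coherent Phi a0 <->
  is_monoid (@rcomp X) (generated (fibers Phi)) /\
  is_identity (@rcomp X) (generated (fibers Phi)) (fiber Phi a0).
Proof.
split=> [coh|[_ [_ neutral]]]; last first.
  by apply: fiber_neutral_coherent => g /generated_sub; exact: neutral.
have id_e : is_identity (@rcomp X) (generated (fibers Phi)) (fiber Phi a0).
  apply: generated_identity; first by exists a0.
  by move=> _ [b _ <-]; exact: coherent_fiber_neutral.
by split=> //; split; [exact: generated_semigroup | exists (fiber Phi a0)].
Qed.
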